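(* For $p>0$ and $x\in(0,\pi/2)$ let $$\varphi_{p,4}(x) = \frac{\sin x}{x} - \frac{2}{\pi} - p\left(\pi^4 - 16x^4\right).$$ Let $p_1 = \frac{1}{2\pi^5} = 0.0016338\ldots$ and $p_2 = \frac{\pi-2}{\pi^5} = 0.0037304\ldots$. Then: (i) If $p \in (0, p_1]$, then for all $x\in(0,\pi/2)$ $$\frac{\sin x}{x} > \frac{2}{\pi} + p_1\left(\pi^4-16x^4\right) \geq \frac{2}{\pi} + p\left(\pi^4-16x^4\right).$$ (ii) If $p \in (p_1,p_2)$, then the equation $\varphi_{p,4}(x)=0$ has a unique solution $x_0^{(p)}$ in $(0,\pi/2)$, and $$x \in \left(0,x_0^{(p)}\right) \Longrightarrow \frac{\sin x}{x} > \frac{2}{\pi} + p\left(\pi^4-16x^4\right), \qquad x\in\left(x_0^{(p)},\frac{\pi}{2}\right) \Longrightarrow \frac{\sin x}{x} < \frac{2}{\pi}+p\left(\pi^4-16x^4\right).$$ (iii) If $p\in[p_2,+\infty)$, then for all $x\in(0,\pi/2)$ $$\frac{\sin x}{x} < \frac{2}{\pi} + p_2\left(\pi^4-16x^4\right) \leq \frac{2}{\pi}+p\left(\pi^4-16x^4\right).$$ (iv) For each $p\in(p_1,p_2]$, the function $\varphi_{p,4}$ has exactly one minimum on $(0,\pi/2)$, at a point $m^{(p)}\in(0,\pi/2)$. (v) The equation $\left|\varphi_{p,4}(0+)\right| = \left|\varphi_{p,4}\left(m^{(p)}\right)\right|$ has, for the parameter $p\in(p_1,p_2)$, the solution $p=p_0$,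 numerically determined as $p_0 = 0.0031146\ldots$. For the value $$d_0 = \left|\varphi_{p_0,4}(0+)\right| = \left|\varphi_{p_0,4}\left(m^{(p_0)}\right)\right| = 0.059981\ldots$$ it holds $$d_0 = \inf_{p\in(0,\infty)}\ \sup_{x\in(0,\pi/2)} \left|\varphi_{p,4}(x)\right|.$$ Hence the minimax approximant of the family $\varphi_{p,4}$ ($p>0$) is $\varphi_{p_0,4}(x) = \frac{\sin x}{x}-\frac{2}{\pi}-p_0\left(\pi^4-16x^4\right)$, which determines the corresponding minimax approximation $\frac{\sin x}{x}\approx \frac{2}{\pi}+p_0\left(\pi^4-16x^4\right)$.
   Context: ''Minimum'' on the open interval $(0,\pi/2)$ in (iv) means local minimum at an interior point. The notation $f(0+)$ means $\lim_{x\to 0+} f(x)$. Minimax approximant: for a family of functions $\varphi_p(x)$, $x \in (a,b)$, $p \in \mathbb{R}^+ = (0,\infty)$, if the infimum over $p$ of the error $d(p) = \sup_{x\in(a,b)}|\varphi_p(x)|$ is attained at $p = p_0 \in \mathbb{R}^+$, then $\varphi_{p_0}$ is called the minimax approximant of the family on $(a,b)$. A decimal followed by ''$\ldots$'' gives the leading digits of the decimal expansion. *)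

(* Defs.v *)
From Stdlib Require Import Reals.
From Coquelicot Require Import Coquelicot.
Open Scope R_scope.

Definition phi4 (p x : R) : R :=
  sin x / x - 2 / PI - p * (PI ^ 4 - 16 * x ^ 4).

Definition is_lim_right (f : R -> R) (a l : R) : Prop :=
  filterlim f (at_right a) (locally l).

Definition is_local_min (f : R -> R) (x : R) : Prop :=
  locally x (fun y => f x <= f y).

(* d(p): supremum of |phi p x| over the open interval (a, b). *)
Definition sup_error (a b : R) (phi : R -> R -> R) (p : R) : Rbar :=
  Lub_Rbar (fun y => exists x, a < x < b /\ y = Rabs (phi p x)).

(* Infimum of d(p) over p > 0.  Parameters with d(p) = +oo contribute no real
   number to the set below; this does not affect the infimum in Rbar, which is
   p_infty when the set is empty. *)
Definition inf_sup_error (a b : R) (phi : R -> R -> R) : Rbar :=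
  Glb_Rbar (fun y => exists p, 0 < p /\ sup_error a b phi p = Finite y).

(* phi p0 is a minimax approximant on (a, b): the infimum is attained at p0. *)
Definition is_minimax (a b : R) (phi : R -> R -> R) (p0 : R) : Prop :=
  0 < p0 /\ sup_error a b phi p0 = inf_sup_error a b phi.

(* Main.v *)
Require Import Defs.
From Stdlib Require Import Reals Lra Ranalysis5 Machin ClassicalEpsilon.
From Coquelicot Require Import Coquelicot.
Open Scope R_scope.

(** Write g(x) = (sin x - x cos x) / x^5 ([slope_ratio]).  Then
    phi4 p has derivative x^3 (64 p - g(x)), and g decreases strictly on
    (0, PI) from +oo, taking the value 64 p1 at PI / 2.  Since phi4 p vanishes
    at PI / 2, two shapes are possible.  If p <= p1, then phi4 p decreases
    to 0, hence is positive.  If p > p1, then phi4 p decreases strictly up to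
    the point m = [argmin p] where g(m) = 64 p and increases strictly to 0
    afterwards; so m is the only local minimum and phi4 p m < 0.  The sign of
    phi4 p before m is then governed by the limit
    A(p) = 1 - 2 / PI - p PI^4 at 0 ([phi4_lim0]), which decreases in p and
    vanishes at p2.  This gives the sign statements.

    For p > p1 the supremum of |phi4 p| is max(|A(p)|, - phi4 p m).  As p
    grows, A(p) decreases, and - phi4 p m increases because PI^4 - 16 x^4 is
    positive.  Hence [balance p] = A(p) + phi4 p m is strictly decreasing; it
    is Lipschitz, so the intermediate value theorem gives it exactly one zero
    p0 ([balanced_parameter_exists]).  There the error equals A(p0).  For
    p < p0 the error is at least A(p) > A(p0), and for p > p0 it is at least
    - phi4 p m > A(p0) ([balanced_error_lt]): p0 is the unique minimax
    parameter.

    The digits follow from the sign of balance at two rational parameters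
    that enclose p0 within 10^-8.  At the upper one a value of phi4 at a
    single point bounds the minimum from above; at the lower one a bound valid
    for all x is required, and it comes from a Taylor polynomial of sin x / x
    written as a nonnegative term plus a nearly constant remainder. *)

(** * Numerical bounds on PI *)

Lemma PI_bounds : 3.1415926535 < PI < 3.1415926536.
Proof.
  generalize (PI_2_3_7_ineq 5).
  unfold tg_alt, PI_2_3_7_tg, Ratan_seq, Rdiv; simpl; lra.
Qed.

Lemma pow_bounds a b x n : 0 <= a -> a <= x <= b -> a ^ n <= x ^ n <= b ^ n.
Proof. intros Ha Hx; split; apply pow_incr; lra. Qed.

Lemma PI_pow4_bounds : 97.409091022 < PI ^ 4 < 97.409091047.
Proof.
  generalize PI_bounds; intros HPI.
  generalize (pow_bounds 3.1415926535 3.1415926536 PI 4 ltac:(lra) ltac:(lra)).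
  lra.
Qed.

Lemma PI_pow5_bounds : 306.019684 < PI ^ 5 < 306.019686.
Proof.
  generalize PI_bounds; intros HPI.
  generalize (pow_bounds 3.1415926535 3.1415926536 PI 5 ltac:(lra) ltac:(lra)).
  lra.
Qed.

Lemma inv_PI_bounds : 0.31830988617 < / PI < 0.31830988620.
Proof.
  generalize PI_bounds; intros HPI.
  assert (E : PI * / PI = 1) by (field; lra).
  assert (0 < / PI) by (apply Rinv_0_lt_compat; lra).
  split; nra.
Qed.

(** * Monotonicity of the slope ratio *)

Lemma strictly_increasing_of_derive f df a b :
  a < b ->
  (forall c, a <= c <= b -> is_derive f c (df c)) ->
  (forall c, a < c < b -> 0 < df c) ->
  f a < f b.
Proof.
  intros Hab Hd Hpos.
  destruct (MVT_cor2 f df a b Hab) as [c [E Hc]].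
  { intros c Hc; apply is_derive_Reals, Hd, Hc. }
  generalize (Rmult_lt_0_compat _ (b - a) (Hpos c Hc) ltac:(lra)); lra.
Qed.

Lemma strictly_decreasing_of_derive f df a b :
  a < b ->
  (forall c, a <= c <= b -> is_derive f c (df c)) ->
  (forall c, a < c < b -> df c < 0) ->
  f b < f a.
Proof.
  intros Hab Hd Hneg.
  enough (- f a < - f b) by lra.
  apply (strictly_increasing_of_derive (fun x => - f x) (fun x => - df x));
    [exact Hab | |].
  - intros c Hc; apply (is_derive_opp f c (df c)), Hd, Hc.
  - intros c Hc; specialize (Hneg c Hc); lra.
Qed.

Lemma x_cos_lt_sin x : 0 < x < PI -> x * cos x < sin x.
Proof.
  intros Hx.
  enough (sin 0 - 0 * cos 0 < sin x - x * cos x) by (rewrite sin_0 in *; lra).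
  apply (strictly_increasing_of_derive
           (fun t => sin t - t * cos t) (fun t => t * sin t)); [lra | |].
  - intros c _; auto_derive; [trivial | ring].
  - intros c Hc; apply Rmult_lt_0_compat; [lra | apply sin_gt_0; lra].
Qed.

(** The right-hand side minus the left-hand side has derivative
    x (3 sin x - x cos x), which is positive because x cos x < sin x.
    The inequality says that [slope_ratio] has a negative derivative. *)
Lemma sin_cos_quintic_bound x :
  0 < x < PI -> x ^ 2 * sin x < 5 * (sin x - x * cos x).
Proof.
  intros Hx.
  enough (5 * (sin 0 - 0 * cos 0) - 0 ^ 2 * sin 0
          < 5 * (sin x - x * cos x) - x ^ 2 * sin x)
    by (rewrite sin_0 in *; lra).
  apply (strictly_increasing_of_derive
           (fun t => 5 * (sin t - t * cos t) - t ^ 2 * sin t)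
           (fun t => t * (3 * sin t - t * cos t))); [lra | |].
  - intros c _; auto_derive; [trivial | ring].
  - intros c Hc.
    assert (0 < sin c) by (apply sin_gt_0; lra).
    assert (c * cos c < sin c) by (apply x_cos_lt_sin; lra).
    apply Rmult_lt_0_compat; lra.
Qed.

(** The derivative of sin x / x, divided by -x^3; the derivative of
    the quartic part of phi4 p, divided by x^3, is the constant 64 p. *)
Definition slope_ratio (x : R) : R := (sin x - x * cos x) / x ^ 5.

Lemma slope_ratio_decreasing x y :
  0 < x < y -> y < PI -> slope_ratio y < slope_ratio x.
Proof.
  intros Hx Hy.
  apply (strictly_decreasing_of_derive slope_ratio
           (fun t => (t ^ 2 * sin t - 5 * (sin t - t * cos t)) / t ^ 6));
    [lra | |].
  - intros c Hc; unfold slope_ratio; auto_derive.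
    + apply (pow_nonzero c 5); lra.
    + field; lra.
  - intros c Hc.
    assert (H : c ^ 2 * sin c < 5 * (sin c - c * cos c))
      by (apply sin_cos_quintic_bound; lra).
    apply Ropp_lt_cancel; rewrite Ropp_0, <- Rdiv_opp_l.
    apply Rdiv_lt_0_compat; [lra | apply pow_lt; lra].
Qed.

Lemma slope_ratio_at_PI2 : slope_ratio (PI / 2) = 32 / PI ^ 5.
Proof.
  unfold slope_ratio; rewrite sin_PI2, cos_PI2; generalize PI_RGT_0; intros.
  field; lra.
Qed.

(** Makes [slope_ratio] at least 1 / (4 x^2) near 0, hence unbounded. *)
Lemma sin_cos_cubic_lower_bound x :
  0 < x <= 1 -> x ^ 3 / 4 <= sin x - x * cos x.
Proof.
  intros Hx; generalize PI_bounds; intros HPI.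
  destruct (sin_bound x 0) as [Hs _]; try lra.
  destruct (cos_bound x 0) as [_ Hc]; try lra.
  unfold sin_approx, cos_approx, sin_term, cos_term in *; simpl in *.
  assert (x * cos x <= x * (1 - x ^ 2 / 2 + x ^ 4 / 24))
    by (apply Rmult_le_compat_l; lra).
  assert (0 <= x ^ 3 * (1 - x ^ 2))
    by (apply Rmult_le_pos; [apply pow_le; lra | nra]).
  assert (0 < x ^ 3) by (apply pow_lt; lra).
  lra.
Qed.

Lemma slope_ratio_attains v :
  slope_ratio (PI / 2) < v -> exists m, 0 < m < PI / 2 /\ slope_ratio m = v.
Proof.
  intros Hv; generalize PI_bounds; intros HPI.
  assert (Hv0 : 0 < v).
  { apply Rlt_trans with (2 := Hv); rewrite slope_ratio_at_PI2.
    apply Rdiv_lt_0_compat; [lra | apply pow_lt; lra]. }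
  (* Any a < 1 with 4 v a^2 < 1 works, by the cubic lower bound; this choice
     has 4 v a < 1. *)
  set (a := / (4 * v + 1)).
  assert (Ha : 0 < a) by (apply Rinv_0_lt_compat; lra).
  assert (Ea : a * (4 * v + 1) = 1) by (unfold a; field; lra).
  assert (Ha1 : a < 1) by nra.
  assert (Hga : v < slope_ratio a).
  { unfold slope_ratio.
    apply Rmult_lt_reg_r with (a ^ 5); [apply pow_lt; lra |].
    unfold Rdiv; rewrite Rmult_assoc, Rinv_l, Rmult_1_r
      by (apply pow_nonzero; lra).
    apply Rlt_le_trans with (2 := sin_cos_cubic_lower_bound a ltac:(lra)).
    replace (v * a ^ 5) with (a ^ 3 * (v * a * a)) by ring.
    apply Rmult_lt_compat_l; [apply pow_lt; lra | nra]. }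
  destruct (IVT_interv (fun x => v - slope_ratio x) a (PI / 2))
    as [m [Hm Em]]; try lra.
  - intros c Hc; apply derivable_continuous_pt.
    apply ex_derive_Reals_0; unfold slope_ratio; auto_derive.
    apply (pow_nonzero c 5); lra.
  - exists m; split; [| lra].
    destruct Hm as [H1 [H2 | H2]]; [lra |].
    rewrite H2 in Em; lra.
Qed.

(** * The shape of phi4 *)

Definition phi4_lim0 (p : R) : R := 1 - 2 / PI - p * PI ^ 4.

Lemma phi4_is_lim_right p : is_lim_right (phi4 p) 0 (phi4_lim0 p).
Proof.
  assert (H : is_lim (phi4 p) 0 (phi4_lim0 p)).
  { replace (phi4_lim0 p) with (1 - 2 / PI - p * (PI ^ 4 - 16 * 0 ^ 4))
      by (unfold phi4_lim0; ring).
    apply is_lim_minus'.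
    - apply is_lim_minus'; [exact is_lim_sinc_0 | apply is_lim_const].
    - apply (is_lim_continuity (fun x => p * (PI ^ 4 - 16 * x ^ 4))).
      reg. }
  apply filterlim_filter_le_1 with (2 := H).
  intros P [e He]; exists e; intros y Hy Hy0; apply He; [exact Hy | lra].
Qed.

Lemma phi4_PI2 p : phi4 p (PI / 2) = 0.
Proof.
  generalize PI_RGT_0; intros; unfold phi4; rewrite sin_PI2; field; lra.
Qed.

Lemma phi4_is_derive p x :
  0 < x -> is_derive (phi4 p) x (x ^ 3 * (64 * p - slope_ratio x)).
Proof.
  intros Hx; unfold phi4, slope_ratio; auto_derive; [lra | field; lra].
Qed.

Lemma phi4_continuity_pt p x : 0 < x -> continuity_pt (phi4 p) x.
Proof.
  intros Hx; apply derivable_continuous_pt, ex_derive_Reals_0.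
  eexists; apply phi4_is_derive, Hx.
Qed.

(** The factor 64 p - slope_ratio x of the derivative increases with
    x, so it is negative before any point where it is at most 0. *)
Lemma phi4_decreasing p m :
  m <= PI / 2 -> 64 * p <= slope_ratio m ->
  forall x y, 0 < x < y -> y <= m -> phi4 p y < phi4 p x.
Proof.
  intros Hm Hp x y Hx Hy.
  apply (strictly_decreasing_of_derive (phi4 p)
           (fun t => t ^ 3 * (64 * p - slope_ratio t))); [lra | |].
  - intros c Hc; apply phi4_is_derive; lra.
  - intros c Hc.
    assert (slope_ratio m < slope_ratio c)
      by (apply slope_ratio_decreasing; lra).
    assert (0 < c ^ 3) by (apply pow_lt; lra).
    nra.
Qed.

Lemma phi4_increasing p m :
  0 < m -> slope_ratio m <= 64 * p ->
  forall x y, m <= x < y -> y <= PI / 2 -> phi4 p x < phi4 p y.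
Proof.
  intros Hm Hp x y Hx Hy.
  apply (strictly_increasing_of_derive (phi4 p)
           (fun t => t ^ 3 * (64 * p - slope_ratio t))); [lra | |].
  - intros c Hc; apply phi4_is_derive; lra.
  - intros c Hc.
    assert (slope_ratio c < slope_ratio m)
      by (apply slope_ratio_decreasing; lra).
    apply Rmult_lt_0_compat; [apply pow_lt|]; lra.
Qed.

(** The critical point equation of phi4 p; its solution is the
    minimizer. *)
Definition is_argmin (p m : R) : Prop :=
  0 < m < PI / 2 /\ slope_ratio m = 64 * p.

Definition argmin (p : R) : R := epsilon (inhabits 0) (is_argmin p).

Definition p1 : R := 1 / (2 * PI ^ 5).
Definition p2 : R := (PI - 2) / PI ^ 5.

Lemma slope_ratio_at_PI2_p1 : slope_ratio (PI / 2) = 64 * p1.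
Proof.
  rewrite slope_ratio_at_PI2; unfold p1; generalize PI_RGT_0; intros.
  field; lra.
Qed.

Lemma phi4_lim0_p2 : phi4_lim0 p2 = 0.
Proof.
  unfold phi4_lim0, p2; generalize PI_RGT_0; intros; field; lra.
Qed.

Lemma phi4_lim0_decreasing p q : p < q -> phi4_lim0 q < phi4_lim0 p.
Proof.
  intros Hpq; unfold phi4_lim0.
  generalize (Rmult_lt_compat_r (PI ^ 4) p q ltac:(apply pow_lt, PI_RGT_0) Hpq).
  lra.
Qed.

Lemma argmin_spec p : p1 < p -> is_argmin p (argmin p).
Proof.
  intros Hp; unfold argmin; apply epsilon_spec; unfold is_argmin.
  apply slope_ratio_attains; rewrite slope_ratio_at_PI2_p1; lra.
Qed.

Lemma argmin_range p : p1 < p -> 0 < argmin p < PI / 2.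
Proof. intros Hp; apply argmin_spec, Hp. Qed.

Lemma phi4_decreasing_before_argmin p : p1 < p ->
  forall x y, 0 < x < y -> y <= argmin p -> phi4 p y < phi4 p x.
Proof.
  intros Hp; destruct (argmin_spec p Hp) as [Hm Em].
  apply phi4_decreasing; lra.
Qed.

Lemma phi4_increasing_after_argmin p : p1 < p ->
  forall x y, argmin p <= x < y -> y <= PI / 2 -> phi4 p x < phi4 p y.
Proof.
  intros Hp; destruct (argmin_spec p Hp) as [Hm Em].
  apply phi4_increasing; lra.
Qed.

Lemma phi4_argmin_le p x :
  p1 < p -> 0 < x < PI / 2 -> phi4 p (argmin p) <= phi4 p x.
Proof.
  intros Hp Hx.
  destruct (Rtotal_order x (argmin p)) as [H | [H | H]].
  - left; apply phi4_decreasing_before_argmin; lra.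
  - rewrite H; lra.
  - left; apply phi4_increasing_after_argmin; lra.
Qed.

Lemma phi4_neg_after_argmin p x :
  p1 < p -> argmin p <= x < PI / 2 -> phi4 p x < 0.
Proof.
  intros Hp Hx; rewrite <- (phi4_PI2 p).
  apply phi4_increasing_after_argmin; lra.
Qed.

Lemma phi4_argmin_neg p : p1 < p -> phi4 p (argmin p) < 0.
Proof.
  intros Hp; generalize (argmin_range p Hp); intros.
  apply phi4_neg_after_argmin; lra.
Qed.

(** Only phi4 p x <= A(p) follows from monotonicity and the limit;
    comparing with the value at x / 2 makes it strict. *)
Lemma phi4_lt_lim0_before_argmin p x :
  p1 < p -> 0 < x <= argmin p -> phi4 p x < phi4_lim0 p.
Proof.
  intros Hp Hx; apply Rlt_le_trans with (phi4 p (x / 2)).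
  { apply phi4_decreasing_before_argmin; lra. }
  apply (filterlim_le (F := at_right 0) (fun _ => phi4 p (x / 2)) (phi4 p)
           (phi4 p (x / 2)) (phi4_lim0 p)).
  - exists (mkposreal (x / 2) ltac:(lra)); intros y Hy Hy0.
    apply Rabs_lt_between' in Hy; simpl in Hy.
    left; apply phi4_decreasing_before_argmin; lra.
  - apply filterlim_const.
  - apply phi4_is_lim_right.
Qed.

Lemma phi4_pos_of_le_p1 p x : p <= p1 -> 0 < x < PI / 2 -> 0 < phi4 p x.
Proof.
  intros Hp Hx; rewrite <- (phi4_PI2 p).
  apply (phi4_decreasing p (PI / 2)); try lra.
  rewrite slope_ratio_at_PI2_p1; lra.
Qed.

Lemma p1_bounds : 0.0016338 <= p1 < 0.0016339.
Proof.
  generalize PI_pow5_bounds PI_bounds; intros H HPI.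
  assert (E : p1 * PI ^ 5 = / 2) by (unfold p1; field; lra).
  split; [apply Rmult_le_reg_r with (PI ^ 5) | apply Rmult_lt_reg_r with (PI ^ 5)];
    lra.
Qed.

Lemma p2_bounds : 0.0037304 <= p2 < 0.0037305.
Proof.
  generalize PI_pow5_bounds PI_bounds; intros H HPI.
  assert (E : p2 * PI ^ 5 = PI - 2) by (unfold p2; field; lra).
  split; [apply Rmult_le_reg_r with (PI ^ 5) | apply Rmult_lt_reg_r with (PI ^ 5)];
    lra.
Qed.

Lemma phi4_p2_neg x : 0 < x < PI / 2 -> phi4 p2 x < 0.
Proof.
  intros Hx; generalize p1_bounds p2_bounds; intros H1 H2.
  destruct (Rle_lt_dec x (argmin p2)).
  - rewrite <- phi4_lim0_p2; apply phi4_lt_lim0_before_argmin; lra.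
  - apply phi4_neg_after_argmin; lra.
Qed.

Lemma quartic_gap_pos x : 0 < x < PI / 2 -> 0 < PI ^ 4 - 16 * x ^ 4.
Proof.
  intros Hx.
  replace (PI ^ 4 - 16 * x ^ 4)
    with ((PI - 2 * x) * (PI + 2 * x) * (PI ^ 2 + 4 * x ^ 2)) by ring.
  apply Rmult_lt_0_compat; [apply Rmult_lt_0_compat; lra |].
  assert (0 < PI ^ 2) by (apply pow_lt; lra).
  generalize (pow2_ge_0 x); lra.
Qed.

(** A point other than the minimizer lies strictly inside one of the
    two branches of strict monotonicity, so moving slightly towards the
    minimizer lowers phi4. *)
Lemma argmin_unique_local_min p : p1 < p ->
  unique (fun x => 0 < x < PI / 2 /\ is_local_min (phi4 p) x) (argmin p).
Proof.
  intros Hp; generalize (argmin_range p Hp); intros Hm.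
  split; [split; [exact Hm |] |].
  - assert (He : 0 < Rmin (argmin p) (PI / 2 - argmin p))
      by (apply Rmin_pos; lra).
    exists (mkposreal _ He); intros y Hy.
    apply Rabs_lt_between' in Hy; simpl in Hy.
    generalize (Rmin_l (argmin p) (PI / 2 - argmin p))
      (Rmin_r (argmin p) (PI / 2 - argmin p)); intros.
    apply phi4_argmin_le; lra.
  - intros x [Hx [e He]]; generalize (cond_pos e); intros Hpos.
    assert (Hball : forall y, Rabs (y - x) < e -> phi4 p x <= phi4 p y)
      by exact He.
    destruct (Rtotal_order x (argmin p)) as [H | [H | H]]; [| auto |].
    + set (d := Rmin (e / 2) (argmin p - x)).
      assert (0 < d) by (apply Rmin_pos; lra).
      assert (d <= e / 2) by apply Rmin_l.
      assert (d <= argmin p - x) by apply Rmin_r.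
      specialize (Hball (x + d)).
      rewrite Rabs_pos_eq in Hball by lra.
      assert (phi4 p (x + d) < phi4 p x)
        by (apply phi4_decreasing_before_argmin; lra).
      lra.
    + set (d := Rmin (e / 2) (x - argmin p)).
      assert (0 < d) by (apply Rmin_pos; lra).
      assert (d <= e / 2) by apply Rmin_l.
      assert (d <= x - argmin p) by apply Rmin_r.
      specialize (Hball (x - d)).
      rewrite Rabs_left1 in Hball by lra.
      assert (phi4 p (x - d) < phi4 p x)
        by (apply phi4_increasing_after_argmin; lra).
      lra.
Qed.

(** The zero lies on the decreasing branch, where phi4 p passes from
    near A(p) > 0 to its negative minimum; the increasing branch stays below
    its end value 0. *)
Lemma phi4_unique_zero p : p1 < p < p2 ->
  exists x0, 0 < x0 < PI / 2 /\ phi4 p x0 = 0 /\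
    (forall x, 0 < x < x0 -> 0 < phi4 p x) /\
    (forall x, x0 < x < PI / 2 -> phi4 p x < 0).
Proof.
  intros [Hp1 Hp2].
  generalize (argmin_range p Hp1) (phi4_argmin_neg p Hp1); intros Hm Hneg.
  assert (Hpos : 0 < phi4_lim0 p)
    by (rewrite <- phi4_lim0_p2; apply phi4_lim0_decreasing, Hp2).
  destruct (phi4_is_lim_right p (fun y => 0 < y)) as [e He].
  { apply open_gt; exact Hpos. }
  set (a := Rmin (e / 2) (argmin p / 2)).
  generalize (cond_pos e); intros Hepos.
  assert (Ha : 0 < a) by (apply Rmin_pos; lra).
  assert (a <= e / 2) by apply Rmin_l.
  assert (a <= argmin p / 2) by apply Rmin_r.
  assert (Hfa : 0 < phi4 p a).
  { apply He; [| exact Ha].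
    apply Rabs_lt_between'; lra. }
  destruct (IVT_interv (fun x => - phi4 p x) a (argmin p))
    as [x0 [Hx0 E0]]; try lra.
  { intros c Hc; apply continuity_pt_opp, phi4_continuity_pt; lra. }
  exists x0; split; [lra | split; [lra | split]].
  - intros x Hx; replace 0 with (phi4 p x0) by lra.
    apply phi4_decreasing_before_argmin; lra.
  - intros x Hx; destruct (Rle_lt_dec x (argmin p)).
    + replace 0 with (phi4 p x0) by lra.
      apply phi4_decreasing_before_argmin; lra.
    + apply phi4_neg_after_argmin; lra.
Qed.

(** * The balance between the limit at 0 and the minimum *)

Definition balance (p : R) : R := phi4_lim0 p + phi4 p (argmin p).

Lemma phi4_diff p q x :
  phi4 q x = phi4 p x - (q - p) * (PI ^ 4 - 16 * x ^ 4).
Proof. unfold phi4; ring. Qed.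

(** The minimizer for p is a test point for q, and phi4 q < phi4 p
    pointwise on (0, PI / 2). *)
Lemma phi4_min_decreasing p q :
  p1 < p < q -> phi4 q (argmin q) < phi4 p (argmin p).
Proof.
  intros Hpq; generalize (argmin_range p ltac:(lra)); intros Hm.
  apply Rle_lt_trans with (phi4 q (argmin p)).
  { apply phi4_argmin_le; lra. }
  rewrite (phi4_diff p q).
  generalize (quartic_gap_pos _ Hm); intros; nra.
Qed.

(** The minimizer for q is a test point for p, and the two functions
    differ by at most (q - p) PI^4. *)
Lemma phi4_min_lipschitz p q :
  p1 < p <= q ->
  phi4 p (argmin p) - (q - p) * PI ^ 4 <= phi4 q (argmin q).
Proof.
  intros Hpq; generalize (argmin_range q ltac:(lra)); intros Hm.
  apply Rle_trans with (phi4 p (argmin q) - (q - p) * PI ^ 4).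
  { generalize (phi4_argmin_le p (argmin q) ltac:(lra) Hm); lra. }
  rewrite (phi4_diff p q).
  assert (0 < argmin q ^ 4) by (apply pow_lt; lra).
  nra.
Qed.

Lemma balance_decreasing p q : p1 < p < q -> balance q < balance p.
Proof.
  intros Hpq; unfold balance.
  generalize (phi4_min_decreasing p q Hpq)
    (phi4_lim0_decreasing p q ltac:(lra)); lra.
Qed.

Lemma balance_lipschitz p q :
  p1 < p <= q -> balance p - 2 * PI ^ 4 * (q - p) <= balance q <= balance p.
Proof.
  intros Hpq; split.
  - generalize (phi4_min_lipschitz p q Hpq).
    unfold balance, phi4_lim0; lra.
  - destruct Hpq as [H1 [H2 | H2]]; [| rewrite H2; lra].
    left; apply balance_decreasing; lra.
Qed.

Lemma balance_continuity_pt p : p1 < p -> continuity_pt balance p.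
Proof.
  intros Hp; apply continuity_pt_locally; intros eps.
  generalize PI_pow4_bounds (cond_pos eps); intros HPI Heps.
  assert (Hd : 0 < Rmin (eps / 200) (p - p1)) by (apply Rmin_pos; lra).
  exists (mkposreal _ Hd); intros q Hq.
  apply Rabs_lt_between' in Hq; simpl in Hq.
  generalize (Rmin_l (eps / 200) (p - p1)) (Rmin_r (eps / 200) (p - p1)).
  intros Hl Hr; apply Rabs_lt_between'.
  destruct (Rle_lt_dec p q) as [H | H].
  - destruct (balance_lipschitz p q); [lra |].
    split; [nra | lra].
  - destruct (balance_lipschitz q p); [lra |].
    split; [lra | nra].
Qed.

Lemma sin_approx_5 x :
  sin_approx x 5 =
  x * (1 - x ^ 2 / 6 + (x ^ 2) ^ 2 / 120 - (x ^ 2) ^ 3 / 5040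
       + (x ^ 2) ^ 4 / 362880 - (x ^ 2) ^ 5 / 39916800).
Proof.
  unfold sin_approx, sin_term; cbn [sum_f_R0 Nat.mul Nat.add].
  rewrite !fact_simpl, !mult_INR, !S_INR; change (INR (Factorial.fact 0)) with 1;
  change (INR 0) with 0; field.
Qed.

Lemma sinc_lower_bound x : 0 < x < PI / 2 ->
  1 - x ^ 2 / 6 + (x ^ 2) ^ 2 / 120 - (x ^ 2) ^ 3 / 5040
    + (x ^ 2) ^ 4 / 362880 - (x ^ 2) ^ 5 / 39916800 <= sin x / x.
Proof.
  intros Hx; apply Rle_div_r; [lra |].
  rewrite Rmult_comm, <- sin_approx_5.
  apply (sin_bound x 2); lra.
Qed.

(** With u = x^2 and p = 0.003114681 the inequality balance p > 0
    reads sin x / x + 16 p u^2 > 4 / PI - 1 + 2 p PI^4 at the minimizer, where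
    the right-hand side is below 0.8800361.  The left-hand side has its
    minimum near u = 1.443. *)
Lemma truncated_sinc_plus_quartic_bound u : 0 <= u <= 2.5 ->
  0.8800361 <
  1 - u / 6 + u ^ 2 / 120 - u ^ 3 / 5040 + u ^ 4 / 362880 - u ^ 5 / 39916800
  + 16 * (3114681 / 1000000000) * u ^ 2.
Proof.
  intros Hu.
  (* Q, b and c come from dividing the polynomial twice by u - 1.443; b is
     about -10^-8 because 1.443 almost is the minimizer. *)
  set (b := -3965106883 / 295680000000000000).
  set (c := 433681918748889881997 / 492800000000000000000).
  set (Q := 21293588704459 / 369600000000000 - 2536262249 / 13305600000000 * u
            + 7651 / 2851200000 * u ^ 2 - / 39916800 * u ^ 3).
  match goal with |- _ < ?L =>
    replace L with (c + b * (u - 1443 / 1000) + (u - 1443 / 1000) ^ 2 * Q)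
      by (unfold b, c, Q; field)
  end.
  assert (0 <= (u - 1443 / 1000) ^ 2 * Q).
  { apply Rmult_le_pos; [apply pow2_ge_0 |].
    generalize (pow_bounds 0 2.5 u 2 ltac:(lra) Hu)
      (pow_bounds 0 2.5 u 3 ltac:(lra) Hu); unfold Q; lra. }
  unfold b, c; lra.
Qed.

Lemma balance_pos_at_lower_end : 0 < balance 0.003114681.
Proof.
  generalize p1_bounds; intros Hp1.
  unfold balance; set (m := argmin _).
  assert (Hm : 0 < m < PI / 2) by (apply argmin_range; lra).
  generalize PI_bounds PI_pow4_bounds inv_PI_bounds; intros HPI H4 Hinv.
  assert (Hu : 0 <= m ^ 2 <= 2.5).
  { generalize (pow_bounds 0 1.58 m 2 ltac:(lra) ltac:(lra)); lra. }
  generalize (sinc_lower_bound m Hm)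
    (truncated_sinc_plus_quartic_bound (m ^ 2) Hu).
  unfold phi4_lim0, phi4, Rdiv in *; lra.
Qed.

Lemma balance_neg_at_upper_end : balance 0.00311469 < 0.
Proof.
  generalize p1_bounds; intros Hp1.
  generalize PI_bounds PI_pow4_bounds inv_PI_bounds; intros HPI H4 Hinv.
  apply Rle_lt_trans with (phi4_lim0 0.00311469 + phi4 0.00311469 1.20125).
  (* 1.20125 approximates the minimizer for parameters near p0. *)
  { apply Rplus_le_compat_l, phi4_argmin_le; lra. }
  assert (Hs : sin 1.20125 / 1.20125 <= 0.7762676).
  { apply Rle_div_l; [lra |].
    destruct (sin_bound 1.20125 2) as [_ H]; try lra.
    apply Rle_trans with (1 := H).
    unfold sin_approx, sin_term; cbn [sum_f_R0 Nat.mul Nat.add].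
    rewrite !fact_simpl, !mult_INR, !S_INR; change (INR (Factorial.fact 0)) with 1;
  change (INR 0) with 0; lra. }
  unfold phi4_lim0, phi4, Rdiv in *; lra.
Qed.

(** The enclosing interval is chosen so narrow that it fixes both
    the digits of p0 and those of A(p0). *)
Lemma balanced_parameter_exists :
  exists p0, 0.003114681 < p0 < 0.00311469 /\ balance p0 = 0.
Proof.
  generalize p1_bounds balance_pos_at_lower_end balance_neg_at_upper_end.
  intros Hp1 Hpos Hneg.
  destruct (IVT_interv (fun p => - balance p) 0.003114681 0.00311469)
    as [p0 [Hp0 E0]]; try lra.
  - intros p Hp; apply continuity_pt_opp, balance_continuity_pt; lra.
  - exists p0; split; [| lra].
    destruct Hp0 as [[H1 | H1] [H2 | H2]];
      solve [lra | rewrite <- H1 in E0; lra | rewrite H2 in E0; lra].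
Qed.

Lemma balance_zero_unique p q :
  p1 < p -> p1 < q -> balance p = 0 -> balance q = 0 -> p = q.
Proof.
  intros Hp Hq Ep Eq.
  destruct (Rtotal_order p q) as [H | [H | H]]; [| exact H |].
  - generalize (balance_decreasing p q ltac:(lra)); lra.
  - generalize (balance_decreasing q p ltac:(lra)); lra.
Qed.

(** * The minimax property *)

Lemma Rabs_le_sup_error a b phi p y x :
  sup_error a b phi p = Finite y -> a < x < b -> Rabs (phi p x) <= y.
Proof.
  intros E Hx.
  destruct (Lub_Rbar_correct
              (fun y => exists x, a < x < b /\ y = Rabs (phi p x))) as [Hub _].
  unfold sup_error in E; rewrite E in Hub.
  apply (Hub (Rabs (phi p x))); exists x; auto.
Qed.

Lemma phi4_lim0_le_sup_error p y :
  sup_error 0 (PI / 2) phi4 p = Finite y -> phi4_lim0 p <= y.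
Proof.
  intros E; generalize PI_RGT_0; intros HPI.
  apply (filterlim_le (F := at_right 0) (phi4 p) (fun _ => y)
           (phi4_lim0 p) y).
  - exists (mkposreal (PI / 2) ltac:(lra)); intros x Hx Hx0.
    apply Rabs_lt_between' in Hx; simpl in Hx.
    apply Rle_trans with (1 := Rle_abs _).
    apply (Rabs_le_sup_error _ _ _ _ _ _ E); lra.
  - apply phi4_is_lim_right.
  - apply filterlim_const.
Qed.

(** The values of phi4 p lie between its minimum, which is - A(p), and
    max(A(p), 0); the supremum A(p) is attained in absolute value at the
    minimizer. *)
Lemma sup_error_balanced p :
  p1 < p -> balance p = 0 ->
  sup_error 0 (PI / 2) phi4 p = Finite (phi4_lim0 p).
Proof.
  unfold balance; intros Hp E; apply is_lub_Rbar_unique; split.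
  - intros y [x [Hx ->]]; simpl; apply Rabs_le; split.
    + generalize (phi4_argmin_le p x Hp Hx); lra.
    + destruct (Rle_lt_dec x (argmin p)).
      * left; apply phi4_lt_lim0_before_argmin; lra.
      * generalize (phi4_neg_after_argmin p x Hp ltac:(lra))
          (phi4_argmin_neg p Hp); lra.
  - intros b Hb; apply Hb; exists (argmin p).
    split; [apply argmin_range, Hp |].
    rewrite Rabs_left; [lra | apply phi4_argmin_neg, Hp].
Qed.

(** A smaller parameter has a larger limit at 0, a larger one has a
    deeper minimum. *)
Lemma balanced_error_lt p0 p y :
  p1 < p0 -> balance p0 = 0 -> p <> p0 ->
  sup_error 0 (PI / 2) phi4 p = Finite y -> phi4_lim0 p0 < y.
Proof.
  intros Hp0 E0 Hne Ey; unfold balance in E0.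
  destruct (Rtotal_order p p0) as [H | [H | H]]; [| contradiction |].
  - apply Rlt_le_trans with (phi4_lim0 p).
    + apply phi4_lim0_decreasing, H.
    + apply phi4_lim0_le_sup_error, Ey.
  - generalize (Rabs_le_sup_error _ _ _ _ _ _ Ey
                  (argmin_range p ltac:(lra))).
    rewrite Rabs_left by (apply phi4_argmin_neg; lra).
    generalize (phi4_min_decreasing p0 p ltac:(lra)); lra.
Qed.

Lemma inf_sup_error_balanced p0 :
  p1 < p0 -> balance p0 = 0 ->
  inf_sup_error 0 (PI / 2) phi4 = Finite (phi4_lim0 p0).
Proof.
  intros Hp0 E0; generalize p1_bounds; intros Hp1.
  apply is_glb_Rbar_unique; split.
  - intros y [p [_ Ey]]; simpl.
    destruct (Req_dec p p0) as [-> | Hne].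
    + rewrite sup_error_balanced in Ey by assumption.
      injection Ey; lra.
    + left; apply (balanced_error_lt p0 p y); assumption.
  - intros b Hb; apply Hb; exists p0; split; [lra |].
    apply sup_error_balanced; assumption.
Qed.

Lemma minimax_unique p0 :
  p1 < p0 -> balance p0 = 0 -> unique (is_minimax 0 (PI / 2) phi4) p0.
Proof.
  intros Hp0 E0; generalize p1_bounds; intros Hp1.
  unfold is_minimax; rewrite (inf_sup_error_balanced p0 Hp0 E0).
  split.
  - split; [lra | apply sup_error_balanced; assumption].
  - intros p [_ Ep]; destruct (Req_dec p p0) as [H | Hne]; [auto |].
    generalize (balanced_error_lt p0 p _ Hp0 E0 Hne Ep); lra.
Qed.

(** For p < p2 the limit is positive and the minimum negative, which
    removes the absolute values. *)
Lemma lim0_abs_eq_min_abs_iff_balance p l :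
  p1 < p < p2 -> is_lim_right (phi4 p) 0 l ->
  (Rabs l = Rabs (phi4 p (argmin p)) <-> balance p = 0).
Proof.
  intros [Hp1 Hp2] Hl.
  replace l with (phi4_lim0 p)
    by exact (filterlim_locally_unique (F := at_right 0) _ _ _
                (phi4_is_lim_right p) Hl).
  assert (0 < phi4_lim0 p)
    by (rewrite <- phi4_lim0_p2; apply phi4_lim0_decreasing, Hp2).
  rewrite Rabs_pos_eq, Rabs_left by (try apply phi4_argmin_neg; lra).
  unfold balance; lra.
Qed.

Theorem mainTheorem7 :
  let p1 := 1 / (2 * PI ^ 5) in
  let p2 := (PI - 2) / PI ^ 5 in
  (0.0016338 <= p1 < 0.0016339) /\
  (0.0037304 <= p2 < 0.0037305) /\
  (* (i) *)
  (forall p, 0 < p <= p1 ->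
     forall x, 0 < x < PI / 2 ->
       sin x / x > 2 / PI + p1 * (PI ^ 4 - 16 * x ^ 4) /\
       2 / PI + p1 * (PI ^ 4 - 16 * x ^ 4)
         >= 2 / PI + p * (PI ^ 4 - 16 * x ^ 4)) /\
  (* (ii) *)
  (forall p, p1 < p < p2 ->
     exists x0,
       unique (fun x => 0 < x < PI / 2 /\ phi4 p x = 0) x0 /\
       (forall x, 0 < x < x0 ->
          sin x / x > 2 / PI + p * (PI ^ 4 - 16 * x ^ 4)) /\
       (forall x, x0 < x < PI / 2 ->
          sin x / x < 2 / PI + p * (PI ^ 4 - 16 * x ^ 4))) /\
  (* (iii) *)
  (forall p, p2 <= p ->
     forall x, 0 < x < PI / 2 ->
       sin x / x < 2 / PI + p2 * (PI ^ 4 - 16 * x ^ 4) /\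
       2 / PI + p2 * (PI ^ 4 - 16 * x ^ 4)
         <= 2 / PI + p * (PI ^ 4 - 16 * x ^ 4)) /\
  exists m : R -> R,
    (* (iv) *)
    (forall p, p1 < p <= p2 ->
       unique (fun x => 0 < x < PI / 2 /\ is_local_min (phi4 p) x) (m p)) /\
    (* (v) *)
    exists p0 l0 d0 : R,
      unique (fun p => p1 < p < p2 /\
                exists l, is_lim_right (phi4 p) 0 l /\
                          Rabs l = Rabs (phi4 p (m p))) p0 /\
      0.0031146 <= p0 < 0.0031147 /\
      is_lim_right (phi4 p0) 0 l0 /\
      d0 = Rabs l0 /\
      d0 = Rabs (phi4 p0 (m p0)) /\
      0.059981 <= d0 < 0.059982 /\
      Finite d0 = inf_sup_error 0 (PI / 2) phi4 /\
      unique (is_minimax 0 (PI / 2) phi4) p0.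
Proof.
  intros q1 q2; change q1 with p1; change q2 with p2; clear q1 q2.
  generalize p1_bounds p2_bounds; intros Hp1 Hp2.
  split; [exact Hp1 | split; [exact Hp2 |]].
  split; [| split; [| split]].
  - intros p Hp x Hx; split.
    + generalize (phi4_pos_of_le_p1 p1 x ltac:(lra) Hx); unfold phi4; lra.
    + generalize (quartic_gap_pos x Hx); intros; nra.
  - intros p Hp; destruct (phi4_unique_zero p Hp) as [x0 [Hx0 [E0 [Hl Hr]]]].
    exists x0; split; [split | split].
    + auto.
    + intros x [Hx Ex]; destruct (Rtotal_order x0 x) as [H | [H | H]].
      * generalize (Hr x ltac:(lra)); lra.
      * exact H.
      * generalize (Hl x ltac:(lra)); lra.
    + intros x Hx; generalize (Hl x Hx); unfold phi4; lra.
    + intros x Hx; generalize (Hr x Hx); unfold phi4; lra.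
  - intros p Hp x Hx; split.
    + generalize (phi4_p2_neg x Hx); unfold phi4; lra.
    + generalize (quartic_gap_pos x Hx); intros; nra.
  - exists argmin; split.
    { intros p Hp; apply argmin_unique_local_min; lra. }
    destruct balanced_parameter_exists as [p0 [Hp0 E0]].
    assert (Hd0 : 0.059981 <= phi4_lim0 p0 < 0.059982).
    { generalize PI_pow4_bounds inv_PI_bounds; intros H4 Hinv.
      unfold phi4_lim0, Rdiv; nra. }
    exists p0, (phi4_lim0 p0), (phi4_lim0 p0).
    repeat match goal with |- _ /\ _ => split end; try lra.
    + split.
      * split; [lra |].
        exists (phi4_lim0 p0); split; [apply phi4_is_lim_right |].
        apply lim0_abs_eq_min_abs_iff_balance;
          [lra | apply phi4_is_lim_right | exact E0].
      * intros p [Hp [l [Hl El]]].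
        apply balance_zero_unique; try lra.
        apply (lim0_abs_eq_min_abs_iff_balance p l Hp Hl), El.
    + apply phi4_is_lim_right.
    + rewrite Rabs_pos_eq; lra.
    + unfold balance in E0; rewrite Rabs_left; lra.
    + rewrite (inf_sup_error_balanced p0); [reflexivity | lra | exact E0].
    + apply minimax_unique; [lra | exact E0].
Qed.
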